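(* Given $\mu,\alpha>0$ and $r\in\mathbb{N}$ with $r\geq 3$, the following holds for all sufficiently large $n$. There exists an $n$-vertex graph $G$ with $$\delta(G)\geq \frac{2-\varrho(K_r)}{3-2\varrho(K_r)}\,n-\mu n\quad\text{and}\quad \alpha(G)\leq \alpha n$$ such that $G$ has no $r$-th power of a Hamilton cycle.
   Context: Graphs are finite and simple; $\delta(G)$ is the minimum degree and $\alpha(G)$ the independence number of $G$ (the plain symbol $\alpha$ is a real constant). The $r$-th power of a graph $H$ is obtained from $H$ by joining every pair of vertices at distance at most $r$ in $H$; an $r$-th power of a Hamilton cycle in $G$ is a (not necessarily induced) spanning subgraph of $G$ that is the $r$-th power of a cycle on $|V(G)|$ vertices. For a graph $H$ and $m,n\in\mathbb{N}$ (or real $m$), the Ramsey--Turán number $\mathbf{RT}(n,H,m)$ is the maximum number of edges in an $n$-vertex $H$-free graph $G$ with $\alpha(G)\le m$. The Ramsey--Turán density of $K_r$ is $\varrho(K_r):=\lim_{\alpha\to 0}\lim_{n\to\infty}\mathbf{RT}(n,K_r,\alpha n)/\binom{n}{2}$. It is known (Erdős--Sós; Erdős--Hajnal--Sós--Szemerédi) that $\varrho(K_r)=1-\frac{2}{r-1}$ if $r$ is odd and $\varrho(K_r)=1-\frac{6}{3r-4}$ if $r$ is even. *)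

(* Defs.v *)
From HB Require Import structures.
From mathcomp Require Import all_boot all_order all_algebra.
From mathcomp Require Import all_classical all_reals all_analysis.

Set Implicit Arguments.
Unset Strict Implicit.
Unset Printing Implicit Defensive.

Import Order.TTheory GRing.Theory Num.Theory.
Import numFieldNormedType.Exports.

Local Open Scope nat_scope.

Record sgraph (T : finType) := SGraph {
  edges : {set {set T}};
  edges_card2 : [forall e in edges, #|e| == 2] }.

HB.instance Definition _ (T : finType) := [isSub for @edges T].
HB.instance Definition _ (T : finType) := [Finite of sgraph T by <:].

Definition adj (T : finType) (G : sgraph T) : rel T :=
  fun x y => [set x; y] \in edges G.

Definition degree (T : finType) (G : sgraph T) (x : T) : nat :=
  #|[set y | adj G x y]|.

(* Degrees are smaller than #|T|, so the neutral element #|T| is harmless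
   unless T is empty. *)
Definition min_degree (T : finType) (G : sgraph T) : nat :=
  \big[minn/#|T|]_(x : T) degree G x.

Definition independent (T : finType) (G : sgraph T) (A : {set T}) : bool :=
  [forall x in A, forall y in A, ~~ adj G x y].

Definition independence_number (T : finType) (G : sgraph T) : nat :=
  \max_(A : {set T} | independent G A) #|A|.

(* G has a not necessarily induced subgraph isomorphic to H; when H and G have
   the same number of vertices, such a subgraph is spanning. *)
Definition contains (T U : finType) (H : sgraph T) (G : sgraph U) : bool :=
  [exists f : {ffun T -> U},
     injectiveb f && [forall x, forall y, adj H x y ==> adj G (f x) (f y)]].

Definition rel_edges (T : finType) (e : rel T) : {set {set T}} :=
  [set [set p.1; p.2] | p : T * T & (p.1 != p.2) && e p.1 p.2].

Lemma rel_edges_card2 (T : finType) (e : rel T) :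
  [forall s in rel_edges e, #|s| == 2].
Proof.
apply/forall_inP => s /imsetP[p]; rewrite inE => /andP[p12 _] ->.
by rewrite cards2 p12.
Qed.

Definition rel_graph (T : finType) (e : rel T) : sgraph T :=
  SGraph (rel_edges_card2 e).

Lemma adj_rel_graph (T : finType) (e : rel T) (x y : T) :
  adj (rel_graph e) x y = (x != y) && (e x y || e y x).
Proof.
apply/imsetP/idP => [[[a b]]|].
  rewrite inE /= => /andP[ab eab] E.
  have xy : x != y.
    by have /eqP := congr1 (fun s : {set T} => #|s|) E; rewrite !cards2 ab; case: (x != y).
  have : x \in [set a; b] by rewrite -E set21.
  have : y \in [set a; b] by rewrite -E set22.
  rewrite xy !inE => /orP[/eqP ya|/eqP yb] /orP[/eqP xa|/eqP xb]; subst;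
    by rewrite ?eqxx ?eab ?orbT // in xy *.
case/andP=> xy /orP[exy|eyx].
  by exists (x, y); rewrite ?inE //= xy.
by exists (y, x); rewrite ?inE /= 1?eq_sym ?xy // finset.setUC.
Qed.

Definition complete_graph (n : nat) : sgraph 'I_n :=
  rel_graph (fun _ _ => true).

(* This is the cycle on n vertices for 3 <= n only; ordS is successor mod n. *)
Definition cycle_graph (n : nat) : sgraph 'I_n :=
  rel_graph (fun i j => j == ordS i).

(* The distance is at most r iff some walk has at most r edges. *)
Definition dist_le (T : finType) (H : sgraph T) (r : nat) : rel T :=
  fun x y => [exists p : r.-bseq T, path (adj H) x p && (last x p == y)].

Definition graph_power (T : finType) (H : sgraph T) (r : nat) : sgraph T :=
  rel_graph (dist_le H r).

Definition has_Hamilton_power (n : nat) (r : nat) (G : sgraph 'I_n) : bool :=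
  contains (graph_power (cycle_graph n) r) G.

Local Open Scope ring_scope.
Local Open Scope classical_set_scope.

(* The maximum over the empty family is 0. *)
Definition ramsey_turan (R : realType) (n : nat) (T : finType) (H : sgraph T)
    (m : R) : nat :=
  (\max_(G : sgraph 'I_n |
      ~~ contains H G && ((independence_number G)%:R <= m)%R) #|edges G|)%N.

Definition ramsey_turan_density (R : realType) (r : nat) : R :=
  lim ((fun a : R =>
          lim ((fun n : nat =>
                  (ramsey_turan n (complete_graph r) (a * n%:R))%:R / 'C(n, 2)%:R : R)
               @ \oo)) @ 0^'+).

(* Main.v *)
Require Import Defs.
From mathcomp Require Import all_boot all_order all_algebra all_reals.
From mathcomp Require Import all_classical all_analysis.
From mathcomp Require Import lra zify.

(* Take two disjoint cliques B1 and B2 of equal size, with no edge between them,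
   both completely joined to a set A of about n / (3 - 2 rho) vertices. On A put
   a K_r-free graph of small independence number and minimum degree close to
   rho |A|; the sizes are chosen so that all degrees are close to
   (2 - rho) / (3 - 2 rho) n. An r-th power of a Hamilton cycle has to pass from
   B1 to B2, and can do so only through r consecutive vertices of A, which would
   form a K_r. The graph on A is a blow-up of a fixed graph, extracted from the
   definition of rho when rho > 0, and obtained from iterated Mycielskians
   (whose fractional chromatic number is unbounded) otherwise. *)

Set Implicit Arguments.
Unset Strict Implicit.
Unset Printing Implicit Defensive.

Import Order.TTheory GRing.Theory Num.Theory.
Import numFieldNormedType.Exports.
Local Open Scope ring_scope.

(** * Adjacency, cliques, independent sets and degrees *)

Lemma adjC (T : finType) (G : sgraph T) (x y : T) : adj G x y = adj G y x.
Proof. by rewrite /adj finset.setUC. Qed.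

Lemma adjxx (T : finType) (G : sgraph T) (x : T) : adj G x x = false.
Proof.
apply/negP => /(forall_inP (edges_card2 G)).
by rewrite finset.setUid cards1.
Qed.

Lemma adj_neq (T : finType) (G : sgraph T) (x y : T) : adj G x y -> x != y.
Proof. by apply: contraTneq => ->; rewrite adjxx. Qed.

Lemma contains_complete (T : finType) (G : sgraph T) (r : nat) :
  reflect (exists f : 'I_r -> T, forall i j, i != j -> adj G (f i) (f j))
          (contains (complete_graph r) G).
Proof.
apply: (iffP existsP) => [[f /andP[_ /'forall_forallP fP]]|[f fP]].
  exists f => i j ij; have := fP i j.
  by rewrite adj_rel_graph ij.
exists [ffun i => f i]; apply/andP; split.
  apply/injectiveP => i j; rewrite !ffunE => fij; apply/eqP/negPn/negP => ij.
  by have := fP _ _ ij; rewrite fij adjxx.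
apply/'forall_forallP => i j; apply/implyP; rewrite !ffunE => /adj_neq.
exact: fP.
Qed.

Lemma contains_complete_hom (T U : finType) (G : sgraph T) (H : sgraph U)
    (h : T -> U) (r : nat) :
  (forall x y, adj G x y -> adj H (h x) (h y)) ->
  contains (complete_graph r) G -> contains (complete_graph r) H.
Proof.
move=> hP /contains_complete[f fP]; apply/contains_complete.
by exists (h \o f) => i j /fP /hP.
Qed.

Lemma card_independent (T : finType) (G : sgraph T) (I : {set T}) :
  independent G I -> (#|I| <= independence_number G)%N.
Proof.
by move=> indI; apply: (leq_bigmax_cond (F := fun A : {set T} => #|A|)).
Qed.

Lemma independentP (T : finType) (G : sgraph T) (I : {set T}) :
  reflect {in I &, forall x y, ~~ adj G x y} (independent G I).
Proof.
apply: (iffP forall_inP) => [h x y xI yI|h x xI].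
  by have /forall_inP := h x xI; apply.
by apply/forall_inP => y yI; apply: h.
Qed.

Lemma independenceP (R : realType) (T : finType) (G : sgraph T) (m : R) :
  0 <= m -> (forall I, independent G I -> #|I|%:R <= m) ->
  (independence_number G)%:R <= m.
Proof.
move=> m0 hm; rewrite /independence_number.
by elim/big_ind: _ => // x y xm ym; rewrite /maxn; case: ifP.
Qed.

Lemma min_degreeP (R : realType) (T : finType) (G : sgraph T) (m : R) :
  m <= #|T|%:R -> (forall x, m <= (degree G x)%:R) -> m <= (min_degree G)%:R.
Proof.
move=> mT hm; rewrite /min_degree.
by elim/big_ind: _ => // x y xm ym; rewrite /minn; case: ifP.
Qed.

Lemma sum_degree (T : finType) (G : sgraph T) :
  (\sum_x degree G x = 2 * #|edges G|)%N.
Proof.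
have -> : (\sum_x degree G x = \sum_x \sum_(e in edges G) (x \in e))%N.
  apply: eq_bigr => x _; rewrite /degree -sum1_card.
  transitivity (\sum_(e in edges G | x \in e) 1)%N; last first.
    by rewrite big_mkcondr; apply: eq_bigr => e _; case: (x \in e).
  have inj : {in [set y | adj G x y] &, injective (fun y => [set x; y])}.
    move=> y z; rewrite !inE => xy xz /setP E.
    have := E y; rewrite !inE eqxx orbT eq_sym (negPf (adj_neq xy)) /=.
    by move=> /esym/eqP.
  rewrite -(big_imset (fun=> 1%N) inj) /=; apply: eq_bigl => e.
  apply/imsetP/andP => [[y]|[eG xe]].
    by rewrite inE => xy ->; split=> //; rewrite set21.
  have /cards2P[a [b [ab E]]] := forall_inP (edges_card2 G) e eG.
  move: (xe); rewrite {1}E !inE => /orP[]/eqP xE.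
    by exists b; rewrite ?inE /adj xE -?E.
  by exists a; rewrite ?inE /adj xE finset.setUC -?E.
rewrite exchange_big /= mulnC -sum_nat_const; apply: eq_bigr => e eG.
rewrite -(eqP (forall_inP (edges_card2 G) e eG)) -sum1_card [RHS]big_mkcond.
by apply: eq_bigr => x _; case: (x \in e).
Qed.

Lemma adj_rel_graph_sym (T : finType) (e : rel T) (x y : T) :
  symmetric e -> irreflexive e -> adj (rel_graph e) x y = e x y.
Proof.
move=> eC exx; rewrite adj_rel_graph (eC y) orbb; apply: andb_idl.
by apply: contraTneq => ->; rewrite exx.
Qed.

(** * Pullbacks: induced subgraphs and blow-ups *)

Section Pullback.
Variables (T U : finType) (G : sgraph T) (h : U -> T).

(** For injective [h] this is an induced subgraph; in general it is a blow-up whose fibres are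
    independent sets. *)
Definition pullback : sgraph U := rel_graph (fun x y => adj G (h x) (h y)).

Lemma adj_pullback x y : adj pullback x y = adj G (h x) (h y).
Proof.
by apply: adj_rel_graph_sym => [? ?|?]; [rewrite adjC | rewrite adjxx].
Qed.

Lemma contains_complete_pullback (r : nat) :
  contains (complete_graph r) pullback -> contains (complete_graph r) G.
Proof. by apply: contains_complete_hom => x y; rewrite adj_pullback; apply. Qed.

Lemma independent_pullback (I : {set U}) :
  independent pullback I -> independent G (h @: I).
Proof.
move/independentP => indI; apply/independentP.
by move=> _ _ /imsetP[x xI ->] /imsetP[y yI ->]; rewrite -adj_pullback indI.
Qed.

End Pullback.

(** * Subsets with large inner degrees *)

Definition inner_degree (T : finType) (G : sgraph T) (S : {set T}) (x : T) : nat :=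
  #|[set y in S | adj G x y]|.

Lemma degree_pullback_val (T : finType) (G : sgraph T) (S : {set T}) (x : {x | x \in S}) :
  degree (pullback G val) x = inner_degree G S (val x).
Proof.
rewrite /degree -(card_imset _ val_inj); apply: eq_card => y.
apply/imsetP/idP => [[z]|].
  by rewrite !inE adj_pullback => xz ->; rewrite (valP z).
rewrite inE => /andP[yS xy].
by exists (exist _ y yS); rewrite ?inE ?adj_pullback.
Qed.

Lemma inner_degreeE (T : finType) (G : sgraph T) (S : {set T}) (x : T) :
  inner_degree G S x = (\sum_(y in S) adj G x y)%N.
Proof.
rewrite /inner_degree -sum1_card big_mkcond [RHS]big_mkcond; apply: eq_bigr => y _.
by rewrite inE; case: (y \in S); case: (adj G x y).
Qed.

(** Deleting [x] costs its inner degree twice: once as its own summand, once as one unit at each of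
    its neighbours. *)
Lemma sum_inner_degreeD1 (T : finType) (G : sgraph T) (S : {set T}) (x : T) :
  x \in S ->
  (\sum_(y in S) inner_degree G S y =
   \sum_(y in S :\ x) inner_degree G (S :\ x) y + 2 * inner_degree G S x)%N.
Proof.
move=> xS; rewrite (big_setD1 x) //=.
have -> : (\sum_(y in S :\ x) inner_degree G S y =
  \sum_(y in S :\ x) inner_degree G (S :\ x) y + inner_degree G S x)%N.
  rewrite [inner_degree G S x]inner_degreeE (big_setD1 (F := fun y => nat_of_bool (adj G x y)) x xS) /=.
  rewrite adjxx add0n -big_split /=.
  apply: eq_bigr => y _.
  by rewrite !inner_degreeE (big_setD1 x xS) /= addnC adjC.
lia.
Qed.

(* [S] maximises [2 e(S) - d |S|^2]; then removing a vertex of [S] does not help,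
   and neither does replacing [S] by the whole vertex set. *)
Lemma dense_subset (R : realType) (T : finType) (G : sgraph T) (d : R) :
  exists S : {set T},
    d * #|T|%:R ^+ 2 + #|S|%:R ^+ 2 * (1 - d) >= 2 * #|edges G|%:R /\
    forall x, x \in S -> d * #|S|%:R - d / 2 <= (inner_degree G S x)%:R.
Proof.
pose P (S : {set T}) : R :=
  (\sum_(x in S) inner_degree G S x)%N%:R - d * #|S|%:R ^+ 2.
have [S Smax] : exists S, forall S', P S' <= P S.
  have [S _ h] := @arg_maxP _ _ _ finset.set0 xpredT P isT.
  by exists S => S'; apply: h.
exists S; split.
  have := Smax [set: T].
  have hT : (\sum_(x in [set: T]) inner_degree G [set: T] x = 2 * #|edges G|)%N.
    rewrite -sum_degree; apply: eq_big => [x|x _]; first by rewrite inE.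
    by apply: eq_card => y; rewrite !inE.
  have hS : (\sum_(x in S) inner_degree G S x <= #|S| ^ 2)%N.
    rewrite -mulnn -sum_nat_const; apply: leq_sum => x _.
    by apply: subset_leq_card; apply/fintype.subsetP => y; rewrite inE => /andP[].
  rewrite /P hT cardsT natrM; move: hS; rewrite -(ler_nat R) natrX; lra.
(* The loss d / 2 comes from |S|^2 - (|S| - 1)^2 = 2|S| - 1. *)
move=> x xS; have := Smax (S :\ x).
rewrite /P (sum_inner_degreeD1 G xS) natrD natrM (cardsD1 x S) xS /= natrD.
set m := #|S :\ x|%:R; nra.
Qed.

(** * Dense models from the Ramsey-Turan density *)

(** All bounds are relative to |T|, so that up to rounding they survive a balanced blow-up to any
    number of vertices. *)
Definition clique_free_model (R : realType) (r : nat) (a d : R) : Prop :=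
  exists (T : finType) (G : sgraph T),
    [/\ (0 < #|T|)%N, ~~ contains (complete_graph r) G,
        forall I, independent G I -> #|I|%:R <= a * #|T|%:R &
        forall x, d * #|T|%:R <= (degree G x)%:R].

(* [lim] is [0] on a divergent function, so both limits in the definition of the
   density exist as soon as they are known to be positive. *)
Lemma dense_clique_free (R : realType) (r : nat) (a d : R) (n0 : nat) :
  0 < a -> 0 <= d -> d < ramsey_turan_density R r ->
  exists n (G : sgraph 'I_n),
    [/\ (n0 <= n)%N, ~~ contains (complete_graph r) G,
        (independence_number G)%:R <= a * n%:R &
        d * 'C(n, 2)%:R <= #|edges G|%:R].
Proof.
move=> a0 d0 drho.
have rho0 : ramsey_turan_density R r != 0 by rewrite gt_eqF // (le_lt_trans d0).
have /(_ _ drho) := cvgr_gt _ (cvgNpoint rho0) d.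
move=> near_d.
have : \forall b \near (0 : R)^'+%classic, b <= a /\ d <
  lim ((fun n : nat =>
                  (ramsey_turan n (complete_graph r) (b * n%:R))%:R / 'C(n, 2)%:R : R)
               @ \oo)%classic.
  near=> b; split; near: b => //.
  exact: nbhs_right_le.
move=> /filter_ex[b [ba]] db.
have l0 := gt_eqF (le_lt_trans d0 db).
have /(_ _ db) nearn := cvgr_gt _ (cvgNpoint (negbT l0)) d.
have : \forall n \near \oo%classic, (n0 <= n)%N /\
  d < (ramsey_turan n (complete_graph r) (b * n%:R))%:R / 'C(n, 2)%:R.
  near=> n; split; near: n => //.
  exact: nbhs_infty_ge.
move=> /filter_ex[n [n0n]] dn.
(* Division by zero gives 0, which cannot exceed [d >= 0]. *)
have C0 : 0 < 'C(n, 2)%:R :> R.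
  rewrite lt0r ler0n andbT; apply: contraTneq dn => ->.
  by rewrite invr0 mulr0 -leNgt.
move: dn; rewrite ltr_pdivlMr // ltNge => /negP; apply: contra_notP => noG.
rewrite /ramsey_turan; apply: (big_ind (fun k : nat => k%:R <= d * 'C(n, 2)%:R))
  => [|x y xm ym|G /andP[GK Ga]].
- by apply: mulr_ge0 => //; apply: ltW.
- by rewrite /maxn; case: ifP.
- rewrite leNgt; apply/negP => Gd; apply: noG; exists n, G; split=> //.
    by rewrite (le_trans Ga) // ler_wpM2r.
  exact: ltW.
Unshelve. all: by end_near.
Qed.

(** In a graph of edge density at least [d2], [dense_subset] finds a part S with inner degrees about
    d1 |S| and with |S| >= c n. Independence number at most a c n is then at most a |S|. *)
Lemma dense_clique_free_model (R : realType) (r : nat) (a d : R) :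
  0 < a -> 0 <= d -> d < ramsey_turan_density R r -> clique_free_model r a d.
Proof.
set rho := ramsey_turan_density R r => a0 d0 drho.
pose d1 := (2 * d + rho) / 3; pose d2 := (d + 2 * rho) / 3.
(* As [c <= 1], its square is at most (d2 - d1) / 2, the bound obtained below for (|S| / n)^2. *)
pose c := Num.min 1 ((d2 - d1) / 2).
have dd1 : d < d1 by rewrite /d1; lra.
have dd2 : d1 < d2 by rewrite /d1 /d2; lra.
have c0 : 0 < c by rewrite lt_min; apply/andP; split; lra.
have c1 : c <= 1 by rewrite ge_min lexx.
have c2 : c <= (d2 - d1) / 2 by rewrite ge_min lexx orbT.
(* The first summand absorbs the loss d1 / 2 in the degrees, the second the gap between n (n - 1)
   and n^2. *)
pose K := d1 / (c * (d1 - d)) + 2 * d2 / (d2 - d1).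
have K1 : 0 <= d1 / (c * (d1 - d)) by rewrite divr_ge0 // ?mulr_ge0; lra.
have K2 : 0 <= 2 * d2 / (d2 - d1) by rewrite divr_ge0; lra.
have [N KN] : exists N : nat, K < N%:R by exists (Num.truncn K).+1; apply: truncnS_gt.
have d20 : 0 <= d2 by lra.
have d2rho : d2 < rho by rewrite /d2; lra.
have [n [G [Nn GK Ga Gd]]] := dense_clique_free (maxn N 1) (mulr_gt0 a0 c0) d20 d2rho.
rewrite geq_max in Nn; case/andP: Nn => Nn n1.
have {KN}Kn : K < n%:R by rewrite (lt_le_trans KN) // ler_nat.
have [S [Sn Sdeg]] := dense_subset G d1.
rewrite card_ord in Sn.
have C2 : 2 * 'C(n, 2)%:R = n%:R * (n%:R - 1) :> R.
  have := mul_bin_diag n 1; rewrite bin1 => /(congr1 (fun k : nat => k%:R : R)).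
  by rewrite !natrM -subn1 natrB // => ->.
set s : R := #|S|%:R in Sn Sdeg; set m : R := n%:R in Sn C2 Kn Ga.
have m1 : 1 <= m by rewrite /m ler1n.
have s0 : 0 <= s by rewrite /s.
have Kd2 : 2 * d2 <= (d2 - d1) * m.
  have : 2 * d2 / (d2 - d1) <= m by move: Kn; rewrite /K; lra.
  by rewrite ler_pdivrMr; lra.
have Kd1 : d1 <= c * (d1 - d) * m.
  have : d1 / (c * (d1 - d)) <= m by move: Kn; rewrite /K; lra.
  by rewrite ler_pdivrMr ?mulr_gt0; lra.
have s_ge : c * m <= s.
  have cm0 : 0 <= c * m by apply: mulr_ge0; lra.
  rewrite -ler_sqr ?nnegrE //.
  have E2 : d2 * (m * (m - 1)) <= 2 * #|edges G|%:R by rewrite -C2; lra.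
  have E3 : (d2 - d1) / 2 * m ^+ 2 <= s ^+ 2 by nra.
  have E4 : c ^+ 2 <= (d2 - d1) / 2 by nra.
  rewrite exprMn; nra.
exists {x | x \in S}, (pullback G val); rewrite card_sig -/s; split.
- by rewrite -(ltr_nat R) -/s; nra.
- exact: contra (@contains_complete_pullback _ _ _ _ _) GK.
- move=> I /independent_pullback/card_independent.
  rewrite (card_imset _ val_inj) -(ler_nat R) => /le_trans; apply; nra.
- move=> x; have := Sdeg _ (valP x); rewrite -degree_pullback_val.
  by apply: le_trans; nra.
Qed.

(** * Triangle-free graphs of large fractional chromatic number *)

Definition triangle_free (T : finType) (G : sgraph T) : Prop :=
  forall x y z, adj G x y -> adj G y z -> ~~ adj G x z.

Lemma triangle_free_complete (T : finType) (G : sgraph T) (r : nat) :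
  (3 <= r)%N -> triangle_free G -> ~~ contains (complete_graph r) G.
Proof.
move=> r3 GT; apply/contains_complete => -[f fP].
have r0 : (0 < r)%N by lia.
have r1 : (1 < r)%N by lia.
have := GT _ _ _ (fP (Ordinal r0) (Ordinal r1) isT) (fP (Ordinal r1) (Ordinal r3) isT).
by rewrite fP.
Qed.

Section Mycielskian.
Variables (T : finType) (G : sgraph T).

(* [inl (inl x)] is the vertex [x], [inl (inr x)] its twin, and [inr tt] the apex. *)
Definition mycielski_rel : rel ((T + T) + unit) := fun p q =>
  match p, q with
  | inl (inl x), inl (inl y) => adj G x y
  | inl (inl x), inl (inr y) => adj G x y
  | inl (inr x), inl (inl y) => adj G x y
  | inl (inr _), inr _ => true
  | inr _, inl (inr _) => true
  | _, _ => false
  end.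

Definition mycielskian := rel_graph mycielski_rel.

Lemma adj_mycielskian p q : adj mycielskian p q = mycielski_rel p q.
Proof.
apply: adj_rel_graph_sym => [[[x|x]|x] [[y|y]|y]|[[x|x]|x]] //=;
  by rewrite ?adjxx // adjC.
Qed.

(** The apex sees only twins, and twins are pairwise non-adjacent; so a triangle would contain no
    apex and at most one twin, and replacing the twin by its original would give a triangle of
    [G]. *)
Lemma mycielskian_triangle_free : triangle_free G -> triangle_free mycielskian.
Proof.
move=> GT [[x|x]|x] [[y|y]|y] [[z|z]|z]; rewrite !adj_mycielskian //=;
  exact: GT.
Qed.

End Mycielskian.

(* By duality, a fractional clique and a fractional colouring of the same total
   weight [W] certify that the fractional chromatic number is [W]. *)
Record fractionally_chromatic (R : realType) (T : finType) (G : sgraph T) (W : R) := {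
  clique_weight : T -> R;
  clique_weight_ge0 : forall x, 0 <= clique_weight x;
  clique_weight_sum : \sum_x clique_weight x = W;
  clique_weight_le1 :
    forall A : {set T}, independent G A -> \sum_(x in A) clique_weight x <= 1;
  color : finType;
  color_class : color -> {set T};
  color_weight : color -> R;
  color_class_independent : forall c, independent G (color_class c);
  color_weight_ge0 : forall c, 0 <= color_weight c;
  color_weight_sum : \sum_c color_weight c = W;
  color_weight_cover : forall x, \sum_(c | x \in color_class c) color_weight c = 1 }.

Arguments color_class {R T G W} f c.
Arguments color_weight {R T G W} f c.
Arguments color_class_independent {R T G W} f c.

(** The colour classes cover each vertex with total weight 1, so the weight of [C] is a combination
    of the weights of its independent parts in the colour classes, with coefficients of sum [W]. *)
Lemma clique_weight_sub (R : realType) (T : finType) (G : sgraph T) (W : R)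
    (F : fractionally_chromatic G W) (C : {set T}) (t : R) :
  (forall J : {set T}, J \subset C -> independent G J ->
     \sum_(x in J) clique_weight F x <= t) ->
  \sum_(x in C) clique_weight F x <= W * t.
Proof.
move=> ht; rewrite -[X in X * t](color_weight_sum F) mulr_suml.
have -> : \sum_(x in C) clique_weight F x =
    \sum_c color_weight F c * \sum_(x in C :&: color_class F c) clique_weight F x.
  under [RHS]eq_bigr do rewrite mulr_sumr.
  rewrite (exchange_big_dep (mem C)) /=; last by move=> c x _; rewrite inE => /andP[].
  apply: eq_bigr => x xC.
  rewrite -[LHS]mul1r -(color_weight_cover F x) mulr_suml; apply: eq_bigl => c.
  by rewrite inE; rewrite xC.
apply: ler_sum => c _; apply: ler_wpM2l; first exact: color_weight_ge0.
apply: ht; first exact: subsetIl.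
apply/independentP => x y; rewrite !inE => /andP[_ xc] /andP[_ yc].
by have /independentP := color_class_independent F c; apply.
Qed.

Lemma big_unit (R : realType) (F : unit -> R) : \sum_u F u = F tt.
Proof. by rewrite (big_pred1 tt) // => -[]. Qed.

Lemma big_sum3 (R : realType) (S T : finType) (P : pred ((S + T) + unit))
    (F : (S + T) + unit -> R) :
  \sum_(p | P p) F p =
    \sum_(x | P (inl (inl x))) F (inl (inl x)) +
    \sum_(x | P (inl (inr x))) F (inl (inr x)) +
    (if P (inr tt) then F (inr tt) else 0).
Proof.
rewrite !big_sumType /=; congr (_ + _).
by rewrite big_mkcond big_unit.
Qed.

(* Larsen, Propp and Ullman: the fractional chromatic number of the
   Mycielskian is [W + 1 / W]. *)
Lemma mycielskian_fractional (R : realType) (T : finType) (G : sgraph T) (W : R) :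
  1 <= W -> fractionally_chromatic G W ->
  fractionally_chromatic (mycielskian G) (W + W^-1).
Proof.
move=> W1 F.
have W0 : 0 < W by lra.
have V0 : 0 < W^-1 by rewrite invr_gt0.
have V1 : W^-1 <= 1 by rewrite invf_le1.
have WV : W * W^-1 = 1 by rewrite divff // gt_eqF.
(* Originals share the weight W - 1, twins the weight 1, and the apex has 1 / W. *)
pose w (p : (T + T) + unit) : R := match p with
  | inl (inl x) => (1 - W^-1) * clique_weight F x
  | inl (inr x) => W^-1 * clique_weight F x
  | inr _ => W^-1 end.
(* Three kinds of independent sets: a colour class with its twins, a colour class with the apex, and
   all the twins. *)
pose cls (c : (color F + color F) + unit) : {set (T + T) + unit} := match c with
  | inl (inl i) => [set p | match p with
      inl (inl x) | inl (inr x) => x \in color_class F i | inr _ => false end]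
  | inl (inr i) => [set p | match p with
      inl (inl x) => x \in color_class F i | inl (inr _) => false | inr _ => true end]
  | inr _ => [set p | if p is inl (inr _) then true else false] end.
pose y (c : (color F + color F) + unit) : R := match c with
  | inl (inl i) => (1 - W^-1) * color_weight F i
  | inl (inr i) => W^-1 * color_weight F i
  | inr _ => W^-1 end.
apply: (@Build_fractionally_chromatic _ _ _ _ w _ _ _ _ cls y).
- case=> [[x|x]|x] /=; last exact: ltW.
    by rewrite mulr_ge0 ?clique_weight_ge0 // subr_ge0.
  by rewrite mulr_ge0 ?clique_weight_ge0 // ltW.
- rewrite big_sum3 /= -!mulr_sumr !clique_weight_sum; lra.
- move=> A /independentP indA.
  pose Av := [set x | inl (inl x) \in A]; pose Au := [set x | inl (inr x) \in A].
  rewrite big_sum3 /= -!mulr_sumr.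
  have -> : \sum_(x | inl (inl x) \in A) clique_weight F x =
            \sum_(x in Av) clique_weight F x by apply: eq_bigl => x; rewrite inE.
  have -> : \sum_(x | inl (inr x) \in A) clique_weight F x =
            \sum_(x in Au) clique_weight F x by apply: eq_bigl => x; rewrite inE.
  have indAv : independent G Av.
    apply/independentP => a b; rewrite !inE => aA bA.
    by have := indA _ _ aA bA; rewrite adj_mycielskian.
  have Av1 := clique_weight_le1 F indAv.
  (* With the apex in [A] there are no twins, and the total is at most (1 - 1 / W) + 1 / W. *)
  case: ifPn => zA.
    have -> : Au = finset.set0.
      apply/setP => a; rewrite !inE; apply/negP => aA.
      by have := indA _ _ aA zA; rewrite adj_mycielskian.
    rewrite big_set0; nra.
  (* [Au] need not be independent, but each independent part of it outside [Av] stays independent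
     together with [Av], so it weighs at most 1 minus the weight of [Av]. *)
  have : \sum_(x in Au :\: Av) clique_weight F x <=
      W * (1 - \sum_(x in Av) clique_weight F x).
    apply: clique_weight_sub => J /fintype.subsetP JC indJ; rewrite lerBrDr.
    have indU : independent G (J :|: Av).
      apply/independentP => a b; rewrite !inE.
      have mixed c d : c \in J -> inl (inl d) \in A -> ~~ adj G c d.
        move=> /JC; rewrite !inE => /andP[_ cA] dA.
        by have := indA _ _ cA dA; rewrite adj_mycielskian.
      case/orP=> [aJ|aA] /orP[bJ|bA].
      + by have /independentP := indJ; apply.
      + exact: mixed.
      + by rewrite adjC; apply: mixed.
      + by have := indA _ _ aA bA; rewrite adj_mycielskian.
    have disj : [disjoint J & Av].
      apply/pred0P => c /=; apply/negP => /andP[/JC].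
      by rewrite !inE => /andP[/negPf ->].
    rewrite -bigU //; apply: le_trans (clique_weight_le1 F indU).
    by rewrite le_eqVlt; apply/orP; left; apply/eqP/eq_bigl => c; rewrite !inE.
  rewrite [\sum_(x in Au) _](big_setID Av) /=.
  have : \sum_(x in Au :&: Av) clique_weight F x <= \sum_(x in Av) clique_weight F x.
    rewrite [leRHS](big_setID Au) /= finset.setIC lerDl.
    by apply: sumr_ge0 => x _; apply: clique_weight_ge0.
  move=> le_p le_q; have := ler_wpM2l (ltW V0) (lerD le_p le_q).
  rewrite (mulrDr _ _ (W * _)) (mulrA _ W) (mulrC _ W) WV; lra.
- move=> c; apply/independentP => p q; rewrite adj_mycielskian.
  have indF i a b : a \in color_class F i -> b \in color_class F i -> ~~ adj G a b.
    by have /independentP := color_class_independent F i; apply.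
  by case: c p q => [[i|i]|i] [[a|a]|a] [[b|b]|b]; rewrite !inE //=; apply: indF.
- case=> [[x|x]|x] /=; last exact: ltW.
    by rewrite mulr_ge0 ?color_weight_ge0 // subr_ge0.
  by rewrite mulr_ge0 ?color_weight_ge0 // ltW.
- rewrite big_sum3 /= -!mulr_sumr !color_weight_sum; lra.
- move=> p; rewrite big_sum3 /=; case: p => [[x|x]|x]; rewrite ?inE /=.
  + under eq_bigl do rewrite inE.
    under [X in _ + X + _]eq_bigl do rewrite inE.
    by rewrite -!mulr_sumr !color_weight_cover; lra.
  + under eq_bigl do rewrite inE.
    under [X in _ + X + _]eq_bigl do rewrite inE.
    by rewrite big_pred0_eq -!mulr_sumr !color_weight_cover; lra.
  + under eq_bigl do rewrite inE.
    under [X in _ + X + _]eq_bigl do rewrite inE.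
    by rewrite big_pred0_eq -!mulr_sumr color_weight_sum; lra.
Qed.

(** Each Mycielskian step raises the square of W by more than 2, since (W + 1 / W)^2 = W^2 + 2 + 1 /
    W^2. The start is a single vertex with W = 1. *)
Lemma large_fractional_chromatic (R : realType) (k : nat) :
  exists (T : finType) (G : sgraph T) (W : R),
    [/\ triangle_free G, 1 <= W, k%:R <= W ^+ 2 & inhabited (fractionally_chromatic G W)].
Proof.
elim: k => [|k [T [G [W [GT W1 kW [F]]]]]].
  pose G : sgraph unit := rel_graph (fun _ _ => false).
  exists unit, G, 1; split => //.
  - by move=> x y z; rewrite adj_rel_graph andbF.
  - exact: exprn_ge0.
  have indG (A : {set unit}) : independent G A.
    by apply/independentP => x y _ _; rewrite adj_rel_graph andbF.
  constructor; apply: (@Build_fractionally_chromatic R _ G 1 (fun=> 1) _ _ _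
    unit (fun=> [set: unit]) (fun=> 1)) => //.
  - by rewrite big_unit.
  - move=> A _; apply: le_trans (_ : \sum_(x : unit) 1 <= 1); last by rewrite big_unit.
    by rewrite [leRHS](bigID (mem A)) /= lerDl sumr_ge0.
  - by rewrite big_unit.
  - by move=> x; rewrite (eq_bigl xpredT) ?big_unit // => c; rewrite inE.
exists ((T + T) + unit)%type, (mycielskian G), (W + W^-1).
have W0 : 0 < W by lra.
have V0 : 0 < W^-1 by rewrite invr_gt0.
have WV : W * W^-1 = 1 by rewrite divff // gt_eqF.
split; [exact: mycielskian_triangle_free | lra | rewrite -natr1; nra |].
by constructor; apply: mycielskian_fractional.
Qed.

(** * Sparse models by weighted blow-up *)

(** Each vertex is blown up in proportion to its clique weight, with factor K = |T| so that rounding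
    adds at most K vertices in all. Independent sets have at most 2 K vertices out of at least K W,
    and a W >= 2. *)
Lemma sparse_clique_free_model (R : realType) (r : nat) (a : R) :
  (3 <= r)%N -> 0 < a -> clique_free_model r a 0.
Proof.
move=> r3 a0.
have [k ak] : exists k : nat, (2 / a) ^+ 2 < k%:R.
  by exists (Num.truncn ((2 / a) ^+ 2)).+1; apply: truncnS_gt.
have [T [G [W [GT W1 kW [F]]]]] := large_fractional_chromatic R k.
have aW : 2 <= a * W.
  rewrite mulrC -ler_pdivrMr // -ler_sqr ?nnegrE ?divr_ge0 ?ltW //; lra.
pose K : R := #|T|%:R; pose w := clique_weight F.
have K0 : 0 < K.
  rewrite ltr0n lt0n; apply: contraTneq W1 => /card0_eq T0.
  by rewrite -(clique_weight_sum F) big_pred0 ?ler10 // -ltNge ltr01.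
pose m x := (Num.truncn (K * w x)).+1.
have wm x : K * w x <= (m x)%:R by apply/ltW/truncnS_gt.
have mw x : (m x)%:R <= K * w x + 1.
  rewrite -natr1 lerD2r truncn_le mulr_ge0 //.
  exact: clique_weight_ge0.
have card_blowup (J : {set T}) :
    #|[set p : {x : T & 'I_(m x)} | tag p \in J]| = (\sum_(x in J) m x)%N.
  rewrite -sum1_card (eq_bigl (fun p : {x : T & 'I_(m x)} => (tag p \in J) && true)); last first.
    by move=> p; rewrite inE andbT.
  rewrite -(sig_big_dep (mem J) (fun _ _ => true) (fun _ _ => 1%N)) /=.
  by apply: eq_bigr => x _; rewrite sum1_card card_ord.
have WK : K * W <= #|{: {x : T & 'I_(m x)}}|%:R.
  have := card_blowup [set: T]; rewrite (eq_card (B := predT)); last by move=> p; rewrite !inE.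
  move=> ->; rewrite natr_sum -(clique_weight_sum F) mulr_sumr.
  by rewrite [leRHS](eq_bigl xpredT) ?ler_sum // => x; rewrite inE.
exists {x : T & 'I_(m x)}, (pullback G tag); split.
- by rewrite -(ltr_nat R); apply: lt_le_trans WK; apply: mulr_gt0; lra.
- exact: contra (@contains_complete_pullback _ _ _ _ _) (triangle_free_complete r3 GT).
- move=> I /independent_pullback indJ.
  set J := (_ @: I) in indJ.
  have : (#|I| <= \sum_(x in J) m x)%N.
    rewrite -card_blowup; apply/subset_leq_card/fintype.subsetP => p pI.
    by rewrite inE; apply: imset_f.
  rewrite -(ler_nat R) => /le_trans; apply.
  have J1 : \sum_(x in J) w x <= 1 by exact: (clique_weight_le1 F indJ).
  have JK : #|J|%:R <= K by rewrite ler_nat max_card.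
  have : (\sum_(x in J) m x)%:R <= K * \sum_(x in J) w x + #|J|%:R.
    rewrite natr_sum mulr_sumr -sum1_card natr_sum -big_split /=.
    exact: ler_sum.
  have : a * (K * W) <= a * #|{: {x : T & 'I_(m x)}}|%:R by rewrite ler_wpM2l // ltW.
  nra.
- by move=> x; rewrite mul0r.
Qed.

(** * Powers of cycles and the obstruction to a Hamilton power *)

Section CyclePower.
Variables (n : nat) (n_gt1 : (1 < n)%N).

(** Positions on the cycle are natural numbers read modulo [n], which avoids wrap-around cases. *)
Definition cyclic_ord (k : nat) : 'I_n := Ordinal (ltn_pmod k (ltnW n_gt1)).

Lemma cyclic_ord_neq (k d : nat) :
  (0 < d)%N -> (d < n)%N -> cyclic_ord k != cyclic_ord (k + d).
Proof.
move=> d0 dn; rewrite -val_eqE /= -{1}[k]addn0 eqn_modDl mod0n modn_small //.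
by rewrite eq_sym -lt0n.
Qed.

Lemma cyclic_ordD (k : nat) : cyclic_ord (k + n) = cyclic_ord k.
Proof. by apply: val_inj; rewrite /= modnDr. Qed.

Lemma cyclic_ord_val (i : 'I_n) : cyclic_ord i = i.
Proof. by apply: val_inj; rewrite /= modn_small. Qed.

Lemma adj_cycle_graph_succ (k : nat) :
  adj (cycle_graph n) (cyclic_ord k) (cyclic_ord k.+1).
Proof.
rewrite adj_rel_graph; have := cyclic_ord_neq k (ltn0Sn 0) n_gt1.
rewrite addn1 => -> /=; apply/orP; left; rewrite -val_eqE /=.
by rewrite -addn1 -modnDml addn1.
Qed.

Lemma adj_cycle_power (r k d : nat) :
  (0 < d)%N -> (d < n)%N -> (d <= r)%N ->
  adj (graph_power (cycle_graph n) r) (cyclic_ord k) (cyclic_ord (k + d)).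
Proof.
move=> d0 dn dr; rewrite adj_rel_graph cyclic_ord_neq //=; apply/orP; left.
pose p := [seq cyclic_ord i | i <- iota k.+1 d].
have sp : (size p <= r)%N by rewrite size_map size_iota.
apply/existsP; exists (Bseq sp) => /=; rewrite /p.
elim: d k {d0 dn dr p sp} => [|d IHd] k /=; first by rewrite addn0 eqxx.
rewrite adj_cycle_graph_succ /= addnS -addSn; exact: IHd.
Qed.

(* Between a vertex of [B1] and one of [B2] the Hamilton cycle would have to
   leave [B1 :|: B2] for [r] consecutive vertices, which form a clique. *)
Lemma no_Hamilton_power (r : nat) (G : sgraph 'I_n) (B1 B2 : {set 'I_n})
    (x1 x2 : 'I_n) :
  (0 < r)%N -> (r < n)%N -> x1 \in B1 -> x2 \in B2 ->
  (forall x y, x \in B1 -> y \in B2 -> x != y /\ ~~ adj G x y) ->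
  (forall f : 'I_r -> 'I_n, (forall i, f i \notin B1 :|: B2) ->
     ~ (forall i j, i != j -> adj G (f i) (f j))) ->
  ~~ has_Hamilton_power r G.
Proof.
move=> r0 rn x1B x2B B12 noK; apply/existsP => -[f /andP[/injectiveP finj /'forall_forallP fG]].
pose F k := f (cyclic_ord k).
have FG k d : (0 < d)%N -> (d < n)%N -> (d <= r)%N -> adj G (F k) (F (k + d)%N).
  by move=> d0 dn dr; apply: (implyP (fG _ _)); apply: adj_cycle_power.
have near i j : (i <= j + r)%N -> (j <= i + r)%N -> F i \in B1 -> F j \in B2 -> False.
  move=> ij ji iB jB; have [neq /negP nadj] := B12 _ _ iB jB.
  case: (ltngtP i j) => [lt_ij|lt_ji|eq_ij].
  - by apply: nadj; rewrite -(subnKC (ltnW lt_ij)) FG //; lia.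
  - by apply: nadj; rewrite adjC -(subnKC (ltnW lt_ji)) FG //; lia.
  - by rewrite eq_ij eqxx in neq.
have window k : exists j, [/\ (k <= j)%N, (j < k + r)%N & F j \in B1 :|: B2].
  apply: contrapT => noj; apply: (noK (fun i : 'I_r => F (k + i)%N)).
    move=> i; apply/negP => iB; apply: noj; exists (k + i)%N.
    by rewrite leq_addr ltn_add2l ltn_ord.
  have lt_adj (i j : 'I_r) : (i < j)%N -> adj G (F (k + i)%N) (F (k + j)%N).
    move=> ij; have := ltn_ord j => jr.
    by rewrite -(subnKC (ltnW ij)) addnA FG //; lia.
  move=> i j; rewrite -val_eqE neq_ltn => /orP[|ji]; first exact: lt_adj.
  by rewrite adjC lt_adj.
have [g fK gK] := injF_bij finj.
(* Shifting by [n] keeps the subtraction of [r < n] below from truncating; the second shift puts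
   [k2] after [k1]. *)
pose k1 : nat := (g x1 + n)%N; pose k2 : nat := (g x2 + n + n)%N.
have F1 : F k1 \in B1 by rewrite /F cyclic_ordD cyclic_ord_val gK.
have F2 : F k2 \in B2 by rewrite /F !cyclic_ordD cyclic_ord_val gK.
have k1n : (n <= k1)%N by rewrite leq_addl.
have k12 : (k1 <= k2)%N by have := ltn_ord (g x1); rewrite /k1 /k2; lia.
(* Every position from [k1] on has a vertex of [B1] among the [r] positions ending there: the next
   window meets [B1 :|: B2], and a vertex of [B2] in it would be too near the previous one of [B1].
   At [k2] this is absurd. *)
have last_B1 m : exists j, [/\ (j <= k1 + m)%N, (k1 + m < j + r)%N & F j \in B1].
  elim: m => [|m [j [jm mj jB]]]; first by exists k1; split=> //; lia.
  have [i [ki ik]] := window (k1 + m.+2 - r)%N.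
  rewrite inE => /orP[iB|iB]; last by case: (near j i) => //; lia.
  by exists i; split=> //; lia.
have [j [jk kj jB]] := last_B1 (k2 - k1)%N.
by apply: (near j k2) => //; lia.
Qed.

End CyclePower.

(** * Counting intervals and residue classes *)

Lemma card_ord_interval (n lo m : nat) :
  (lo + m <= n)%N -> #|[set y : 'I_n | (lo <= y < lo + m)%N]| = m.
Proof.
move=> lmn; rewrite -[RHS](size_iota lo m) cardE -(size_map val).
apply/perm_size/uniq_perm.
- by rewrite (map_inj_uniq val_inj) enum_uniq.
- exact: iota_uniq.
move=> k; rewrite mem_iota; apply/mapP/idP => [[y]|kI].
  by rewrite mem_enum inE => ? ->.
have kn : (k < n)%N by lia.
by exists (Ordinal kn); rewrite // mem_enum inE.
Qed.

Lemma card_residue_le (n N c v : nat) :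
  (#|[set y : 'I_n | (c <= y) && ((y - c) %% N == v)]| <= (n %/ N).+1)%N.
Proof.
rewrite -[leqRHS](card_ord (n %/ N).+1).
have inj : {in [set y : 'I_n | (c <= y)%N && ((y - c) %% N == v)%N] &,
    injective (fun y : 'I_n => inord ((y - c) %/ N) : 'I_(n %/ N).+1)}.
  move=> y z; rewrite !inE => /andP[cy /eqP yv] /andP[cz /eqP zv] /(congr1 val) /=.
  have yn := ltn_ord y; have zn := ltn_ord z.
  rewrite !inordK ?ltnS ?leq_div2r //; try lia.
  move=> E; apply: val_inj => /=.
  have := divn_eq (y - c) N; have := divn_eq (z - c) N; rewrite E yv zv; lia.
by rewrite -(card_in_imset inj) max_card.
Qed.

Lemma card_residue_ge (n N c v : nat) :
  (v < N)%N ->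
  ((n - c) %/ N <= #|[set y : 'I_n | (c <= y) && ((y - c) %% N == v)]|)%N.
Proof.
move=> vN; rewrite -[leqLHS](card_ord ((n - c) %/ N)).
have bound (k : 'I_((n - c) %/ N)) : (c + (k * N + v) < n)%N.
  have := leq_mul (ltn_ord k) (leqnn N).
  have := leq_trunc_div (n - c) N; rewrite mulSn; lia.
have inj : injective (fun k => Ordinal (bound k)).
  move=> k l /(congr1 val) /= E; apply: val_inj => /=.
  have /eqP : (k * N = l * N)%N by lia.
  by rewrite eqn_pmul2r; [move/eqP | lia].
rewrite -(card_imset _ inj); apply/subset_leq_card/fintype.subsetP => _ /imsetP[k _ ->].
by rewrite inE /= leq_addr addKn modnMDl modn_small // eqxx.
Qed.

(** * Two cliques joined to a blow-up *)

Section Construction.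
Variables (T : finType) (H : sgraph T) (T_gt0 : (0 < #|T|)%N) (n b : nat).
Hypothesis b2n : (b + b <= n)%N.

(** Residues modulo |T| spread the outer vertices evenly over [T]. Below 2b the subtraction
    truncates to 0; adjacency consults the value only for outer vertices. *)
Definition blowup_proj (y : 'I_n) : T := enum_val (Ordinal (ltn_pmod (y - (b + b)) T_gt0)).

Definition outer (y : 'I_n) : bool := (b + b <= y)%N.

(* Vertices below [b] and those in [b, 2b) form two cliques; the remaining ones
   carry a blow-up of [H] and are joined to both cliques. *)
Definition clique_blowup_rel : rel 'I_n := fun x y =>
  if outer x && outer y then adj H (blowup_proj x) (blowup_proj y)
  else if outer x || outer y then true
  else (x != y) && ((x < b) == (y < b))%N.

Definition clique_blowup := rel_graph clique_blowup_rel.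

Lemma adj_clique_blowup x y : adj clique_blowup x y = clique_blowup_rel x y.
Proof.
apply: adj_rel_graph_sym => [{}x {}y|{}x]; rewrite /clique_blowup_rel.
  by rewrite andbC adjC orbC eq_sym [((x < b) == _)%N]eq_sym.
by rewrite andbb orbb adjxx eqxx; case: outer.
Qed.

Definition fibre (v : T) : {set 'I_n} := [set y | outer y && (blowup_proj y == v)].

Lemma fibreE (v : T) :
  fibre v = [set y : 'I_n | (b + b <= y)%N && ((y - (b + b)) %% #|T| == enum_rank v)%N].
Proof.
apply/setP => y; rewrite !inE; congr (_ && _).
by rewrite /blowup_proj (can2_eq (@enum_valK T) (@enum_rankK T)) -val_eqE.
Qed.

Lemma card_fibre_le v : (#|fibre v| <= (n %/ #|T|).+1)%N.
Proof. by rewrite fibreE card_residue_le. Qed.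

Lemma card_fibre_ge v : ((n - (b + b)) %/ #|T| <= #|fibre v|)%N.
Proof. by rewrite fibreE card_residue_ge. Qed.

Lemma card_wrap_preimage (P : pred T) :
  #|[set y | outer y && P (blowup_proj y)]| = (\sum_(v | P v) #|fibre v|)%N.
Proof.
rewrite -sum1_card (partition_big blowup_proj P) /=; last by move=> y; rewrite inE => /andP[].
apply: eq_bigr => v Pv; rewrite -sum1_card; apply: eq_bigl => y.
by rewrite !inE; case: eqP => [->|_]; rewrite ?Pv ?andbT ?andbF.
Qed.

(** An outer vertex sees both cliques and the whole fibre over each neighbour of its projection. *)
Lemma degree_clique_blowup_outer (x : 'I_n) :
  outer x ->
  (b + b + degree H (blowup_proj x) * ((n - (b + b)) %/ #|T|) <= degree clique_blowup x)%N.
Proof.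
move=> ox; rewrite -[X in (X + _ <= _)%N](@card_ord_interval n 0 (b + b)) //.
rewrite [degree clique_blowup x]/degree.
have -> : [set y | adj clique_blowup x y] =
  [set y : 'I_n | (0 <= y < 0 + (b + b))%N] :|:
  [set y | outer y && adj H (blowup_proj x) (blowup_proj y)].
  apply/setP => y; rewrite !inE adj_clique_blowup /clique_blowup_rel ox /=.
  by rewrite add0n ltnNge -/(outer y); case: (outer y).
rewrite cardsU (_ : _ :&: _ = finset.set0) ?cards0 ?subn0; last first.
  by apply/setP => y; rewrite !inE add0n ltnNge -/(outer y); case: (outer y).
rewrite leq_add2l card_wrap_preimage /degree -sum_nat_const big_set.
by apply: leq_sum => v _; apply: card_fibre_ge.
Qed.

Lemma degree_clique_blowup_inner (x : 'I_n) :
  ~~ outer x -> (n <= degree clique_blowup x + b + 1)%N.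
Proof.
(* The clique not containing [x] starts at [lo]; it and [x] itself are the only non-neighbours. *)
move=> ox; pose lo := (if x < b then b else 0)%N.
have lon : (lo + b <= n)%N by rewrite /lo; case: ifP; lia.
rewrite -[X in (X <= _)%N]card_ord -(cardC (mem [set y | adj clique_blowup x y])).
rewrite -addnA leq_add2l -[X in (_ <= X + _)%N](card_ord_interval lon) -(cards1 x).
apply: leq_trans (leq_card_setU _ _); apply/subset_leq_card/fintype.subsetP => y.
rewrite !inE adj_clique_blowup /clique_blowup_rel (negPf ox) /=.
case oy: (outer y) => //=; rewrite negb_and negbK [_ == x]eq_sym.
case: eqP => //= _; rewrite ?orbF ?orbT //.
move: oy; rewrite /outer /lo; case: (ltnP x b); case: (ltnP y b) => //=; lia.
Qed.

(** Each clique contributes at most one vertex, and the outer part lies in the fibres over an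
    independent set of [H]. *)
Lemma independent_clique_blowup (I : {set 'I_n}) :
  independent clique_blowup I ->
  (#|I| <= 2 + independence_number H * (n %/ #|T|).+1)%N.
Proof.
move=> /independentP indI.
have -> : I = (I :&: [set y | ~~ outer y & (y < b)%N] :|:
    I :&: [set y | ~~ outer y & (b <= y)%N]) :|: I :&: [set y | outer y].
  apply/setP => y; rewrite !inE -!andb_orr; case: (y \in I) => //=.
  by case: outer => //=; case: ltnP.
apply: leq_trans (leq_card_setU _ _) _; apply: leq_add.
  apply: leq_trans (leq_card_setU _ _) _; rewrite -[2%N]/(1 + 1)%N.
  have le1 (P : pred 'I_n) : (forall x y, P x -> P y -> ((x < b) == (y < b))%N) ->
      (#|I :&: [set y | ~~ outer y & P y]| <= 1)%N.
    move=> hP; apply/card_le1_eqP => x y; rewrite !inE.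
    move=> /andP[xI /andP[ox Px]] /andP[yI /andP[oy Py]].
    have := indI _ _ xI yI; rewrite adj_clique_blowup /clique_blowup_rel.
    by rewrite (negPf ox) (negPf oy) /= hP // andbT negbK => /eqP.
  apply: leq_add; apply: (le1 (fun y => _)) => x y /=; first by move=> -> ->.
  by rewrite ltnNge => ->; rewrite ltnNge => ->.
set J := I :&: _.
have indJ : independent H (blowup_proj @: J).
  apply/independentP => _ _ /imsetP[x xJ ->] /imsetP[y yJ ->].
  move: xJ yJ; rewrite !inE => /andP[xI ox] /andP[yI oy].
  by have := indI _ _ xI yI; rewrite adj_clique_blowup /clique_blowup_rel ox oy.
apply: (@leq_trans #|[set y | outer y && (blowup_proj y \in blowup_proj @: J)]|).
  apply/subset_leq_card/fintype.subsetP => y yJ; rewrite inE imset_f // andbT.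
  by move: yJ; rewrite !inE => /andP[].
rewrite (card_wrap_preimage (mem (blowup_proj @: J))).
apply: (@leq_trans (\sum_(v in blowup_proj @: J) (n %/ #|T|).+1)%N).
  by apply: leq_sum => v _; apply: card_fibre_le.
by rewrite sum_nat_const leq_mul2r card_independent // orbT.
Qed.

Lemma no_Hamilton_power_clique_blowup (r : nat) :
  (0 < b)%N -> (1 < r)%N -> (r < n)%N -> ~~ contains (complete_graph r) H ->
  ~~ has_Hamilton_power r clique_blowup.
Proof.
move=> b0 r1 rn HK; have n0 : (0 < n)%N by lia.
have bn : (b < n)%N by lia.
have n1 : (1 < n)%N by lia.
apply: (@no_Hamilton_power n n1 r clique_blowup
  [set y : 'I_n | (y < b)%N] [set y : 'I_n | ~~ outer y & (b <= y)%N]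
  (Ordinal n0) (Ordinal bn)) => //.
- by lia.
- by rewrite inE.
- by rewrite !inE /outer /=; lia.
- move=> x y; rewrite !inE => xb /andP[oy yb]; rewrite adj_clique_blowup /clique_blowup_rel.
  have ox : ~~ outer x by rewrite /outer; lia.
  rewrite (negPf ox) (negPf oy) /= xb ltnNge yb andbF; split=> //.
  by apply: contraTneq xb => ->; rewrite -leqNgt.
- move=> f fB fG; move/negP: HK; apply; apply/contains_complete.
  exists (blowup_proj \o f) => i j ij /=.
  have of_ k : outer (f k) by have := fB k; rewrite !inE; case: outer => //=; lia.
  by have := fG i j ij; rewrite adj_clique_blowup /clique_blowup_rel !of_.
Qed.

End Construction.

(** * Choice of parameters and conclusion *)

Lemma clique_free_model_le1 (R : realType) (r : nat) (a d : R) :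
  clique_free_model r a d -> d <= 1.
Proof.
move=> [T [H [T0 _ _ degH]]].
have [x _] := card_gt0P T0.
have degT : (degree H x)%:R <= #|T|%:R :> R by rewrite ler_nat max_card.
by rewrite -(ler_pM2r (_ : 0 < #|T|%:R :> R)) ?ltr0n // mul1r (le_trans (degH x)).
Qed.

(** A density above 1 would yield a model whose degrees exceed |T|. The sign of the density is not
    presupposed: if it is at most 0, the sparse models serve with d = 0. *)
Lemma near_optimal_model (R : realType) (r : nat) (a eps : R) :
  (3 <= r)%N -> 0 < a -> 0 < eps ->
  ramsey_turan_density R r <= 1 /\
  exists d, [/\ 0 <= d, ramsey_turan_density R r - eps <= d & clique_free_model r a d].
Proof.
set rho := ramsey_turan_density R r => r3 a0 eps0; split.
  rewrite leNgt; apply/negP => rho1.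
  have /clique_free_model_le1 : clique_free_model r a ((1 + rho) / 2).
    by apply: dense_clique_free_model; rewrite // -/rho; lra.
  lra.
have [rho0|rho0] := leP rho 0.
  by exists 0; split=> //; [lra | exact: sparse_clique_free_model].
exists (Num.max 0 (rho - eps)); split; rewrite ?le_max ?lexx ?orbT //.
apply: dense_clique_free_model; rewrite ?le_max ?lexx // gt_max -/rho.
by apply/andP; split; lra.
Qed.

(** The two upper bounds on [m] treat clique vertices and outer vertices; rounding down the fibre
    sizes costs at most d |T| <= |T|. *)
Lemma clique_blowup_min_degree (R : realType) (T : finType) (H : sgraph T)
    (T_gt0 : (0 < #|T|)%N) (n b : nat) (d m : R) :
  (b + b <= n)%N -> (0 < b)%N -> 0 <= d <= 1 ->
  (forall x, d * #|T|%:R <= (degree H x)%:R) ->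
  m <= n%:R - b%:R - 1 ->
  m <= 2 * b%:R + d * (n%:R - 2 * b%:R) - #|T|%:R ->
  m <= (min_degree (@clique_blowup T H T_gt0 n b))%:R.
Proof.
move=> b2n b0 /andP[d0 d1] degH m1 m2.
apply: min_degreeP => [|x].
  by rewrite card_ord; have : 0 <= b%:R :> R by []; lra.
have [ox|ox] := boolP (outer b x); last first.
  have := degree_clique_blowup_inner H T_gt0 b2n ox.
  by rewrite -(ler_nat R) !natrD; lra.
have := degree_clique_blowup_outer H T_gt0 b2n ox.
set q := (_ %/ _)%N; set t := blowup_proj _ _ _.
rewrite -(ler_nat R) !natrD natrM => /(le_trans _); apply.
have qT : n%:R - 2 * b%:R <= #|T|%:R * q%:R + #|T|%:R :> R.
  have : (n - (b + b) <= #|T| * q + #|T|)%N.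
    have := divn_eq (n - (b + b)) #|T|; have := ltn_pmod (n - (b + b)) T_gt0.
    by rewrite -/q; nia.
  by rewrite -(ler_nat R) natrB // !natrD natrM; lra.
have T0 : 0 <= #|T|%:R :> R by [].
have := ler_wpM2r (ler0n R q) (degH t).
have := ler_wpM2l d0 qT; nra.
Qed.

Theorem proposition1p4 (R : realType) (mu alpha : R) (r : nat)
    (mu_gt0 : 0 < mu) (alpha_gt0 : 0 < alpha) (r_ge3 : (3 <= r)%N) :
  let rho := ramsey_turan_density R r in
  exists n0 : nat, forall n : nat, (n0 <= n)%N ->
    exists G : sgraph 'I_n,
      [/\ (2 - rho) / (3 - 2 * rho) * n%:R - mu * n%:R <= (min_degree G)%:R,
          (independence_number G)%:R <= alpha * n%:R
        & ~~ has_Hamilton_power r G].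
Proof.
move=> rho.
have a0 : 0 < alpha / 2 by rewrite divr_gt0.
have [rho1 [d [d0 rhod [T [H [T0 HK indH degH]]]]]] :=
  near_optimal_model r_ge3 a0 (divr_gt0 mu_gt0 (ltr0Sn R 1)).
have d1 : d <= 1 by apply: (@clique_free_model_le1 _ r (alpha / 2)); exists T, H.
(* Here [x] is the intended share of the outer part, and (2 - rho') / (3 - 2 rho') = (1 + x) / 2.
   This increases with the density, so replacing [rho] by [rho'] only strengthens the degree
   bound. *)
pose rho' := Num.max 0 rho; pose x := (3 - 2 * rho')^-1.
have rho'0 : 0 <= rho' by rewrite le_max lexx.
have rho'1 : rho' <= 1 by rewrite ge_max ler01.
have rho'd : rho' - mu / 2 <= d.
  by rewrite lerBlDr ge_max; apply/andP; split; rewrite -/rho in rhod; lra.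
have xE : x * (3 - 2 * rho') = 1 by rewrite mulVf // gt_eqF //; lra.
have x3 : 3^-1 <= x by rewrite lef_pV2 ?posrE; lra.
have x1 : x <= 1 by rewrite invf_le1; lra.
have DE : (2 - rho) / (3 - 2 * rho) <= (1 + x) / 2.
  have rr : rho <= rho' by rewrite le_max lexx orbT.
  rewrite ler_pdivrMr; last by lra.
  have : x * (3 - 2 * rho') <= x * (3 - 2 * rho) by apply: ler_wpM2l; lra.
  lra.
pose beta := (1 - x) / 2.
(* The summands serve, in order, the degree bound, the independence bound, [b + b <= n] (as
   [beta <= 1 / 3]) and [r < n]. *)
pose K := 2 * (#|T|%:R + 2) / mu + (2 + alpha / 2 * #|T|%:R) * 2 / alpha + 6 + r%:R.
exists (Num.truncn K).+1 => n Kn.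
have {}Kn : K < n%:R by apply: lt_le_trans (truncnS_gt K) _; rewrite ler_nat.
set t : R := #|T|%:R in indH degH K Kn.
have t0 : 0 <= t by [].
have K1 : 0 <= 2 * (t + 2) / mu by apply: divr_ge0; lra.
have K2 : 0 <= (2 + alpha / 2 * t) * 2 / alpha.
  by have := mulr_ge0 (ltW a0) t0 => ?; apply: divr_ge0; lra.
have n_mu : t + 2 <= mu / 2 * n%:R.
  have : 2 * (t + 2) / mu <= n%:R by move: Kn; rewrite /K; have := ler0n R r; lra.
  by rewrite ler_pdivrMr; lra.
have n_alpha : 2 + alpha / 2 * t <= alpha / 2 * n%:R.
  have : (2 + alpha / 2 * t) * 2 / alpha <= n%:R.
    by move: Kn; rewrite /K; have := ler0n R r; lra.
  by rewrite ler_pdivrMr; lra.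
have n6 : 6 <= n%:R :> R by move: Kn; rewrite /K; have := ler0n R r; lra.
have rn : (r < n)%N by rewrite -(ltr_nat R); move: Kn; rewrite /K; lra.
(* The successor keeps the cliques nonempty even if [beta] is 0, which happens for rho' = 1. *)
pose b := (Num.truncn (beta * n%:R)).+1.
have bn0 : 0 <= beta * n%:R by rewrite mulr_ge0 // /beta; lra.
have b_ge : beta * n%:R <= b%:R by apply/ltW/truncnS_gt.
have b_le : b%:R <= beta * n%:R + 1 by rewrite -natr1 lerD2r truncn_le.
have b2n : (b + b <= n)%N.
  rewrite -(ler_nat R) natrD; have : beta * n%:R <= 3^-1 * n%:R.
    by rewrite ler_wpM2r // /beta; lra.
  lra.
exists (clique_blowup H T0 n b); split.
- apply: (@clique_blowup_min_degree _ _ _ _ _ _ d) => //; first by rewrite d0.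
    have := ler_wpM2r (ler0n R n) DE; move: b_le; rewrite /beta; lra.
  have : (rho' - mu / 2) * (n%:R - 2 * b%:R) <= d * (n%:R - 2 * b%:R).
    by rewrite ler_wpM2r // subr_ge0; move: b2n; rewrite -(ler_nat R) natrD; lra.
  have : (1 - rho') * (beta * n%:R) <= (1 - rho') * b%:R by rewrite ler_wpM2l ?subr_ge0.
  have := mulr_ge0 (ltW mu_gt0) (ler0n R b).
  have := ler_wpM2r (ler0n R n) DE.
  (* Inner and outer degrees balance here; the identity amounts to x (3 - 2 rho') = 1. *)
  have : (2 * (1 - rho') * beta + rho') * n%:R = (1 + x) / 2 * n%:R.
    by congr (_ * _); rewrite /beta; lra.
  rewrite -/t; lra.
- apply: independenceP => [|I indI]; first by rewrite mulr_ge0 // ltW.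
  have := independent_clique_blowup indI.
  rewrite -(ler_nat R) natrD natrM => /le_trans; apply.
  have indH' : (independence_number H)%:R <= alpha / 2 * t.
    by apply: independenceP => //; rewrite mulr_ge0 // ltW.
  have qn : t * (n %/ #|T|)%:R <= n%:R by rewrite -natrM ler_nat mulnC leq_trunc_div.
  have := ler_wpM2r (ler0n R (n %/ #|T|).+1) indH'.
  rewrite -natr1; have := ler_wpM2l (ltW a0) qn; lra.
- exact: (no_Hamilton_power_clique_blowup T0 b2n (ltn0Sn _) (ltnW r_ge3) rn HK).
Qed.
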